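(* Let $K$ be a compact Hausdorff space, $X$ a Banach space and $(f_s)_{s\in S}$, $f_s:K\to X$, a normalized family of continuous functions. Assume that for every maximal chain $\beta\in\mathcal{C}(S)$, the sequence $(f_s)_{s\in\beta}$ converges pointwise to zero and there exists a positive integer $J_\beta$ such that $\mathrm{card}(f_s[K])\le J_\beta$ for every $s\in\beta$. Then there exist a subtree $T$ of $S$ and a constant $C\ge1$ such that for every chain $\beta$ of $T$, the sequence $(f_s)_{s\in\beta}$ is $C$-unconditional.
   Context: $S=\bigcup_{n=0}^\infty\{0,1\}^n$ is the dyadic tree of all finite sequences in $\{0,1\}$ (including the empty one), partially ordered by the initial segment relation $\le$. A subtree of $S$ is a subset $T\subseteq S$, with the induced order, which has a single minimal element and in which every element has exactly two immediate successors (i.e. for each $t\in T$ there are exactly two minimal elements of $\{t'\in T: t<t'\}$); thus $T$ is order isomorphic to $S$. A chain of a tree $T$ is an infinite linearly ordered subset of $T$; $\mathcal{C}(T)$ is the set of all chains of $T$; a maximal chain is one that is maximal under inclusion. For a chain $\beta$ with elements enumerated increasingly as $s_1<s_2<\cdots$, $(f_s)_{s\in\beta}$ denotes the sequence $(f_{s_i})_{i=1}^\infty$. Continuous functions $f:K\to X$ are regarded as elements of the Banach space $C(K,X)$ with norm $\|f\|=\sup_{x\in K}\|f(x)\|$; normalized means $\|f_s\|=1$ for all $s$. A sequence $(y_i)$ in a Banach space is $C$-unconditional if for every $n\in\mathbb{N}$, all $a_1,\ldots,a_n\in\mathbb{R}$ and every $A\subseteq\{1,\ldots,n\}$, $\|\sum_{i\in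 A}a_iy_i\|\le C\|\sum_{i=1}^na_iy_i\|$. *)

(* Defs.v *)
From HB Require Import structures.
From mathcomp Require Import all_boot all_order all_algebra.
From mathcomp Require Import all_classical all_reals all_analysis.
Import Order.TTheory GRing.Theory Num.Theory.
Import numFieldNormedType.Exports.

Set Implicit Arguments.
Unset Strict Implicit.
Unset Printing Implicit Defensive.

Local Open Scope classical_set_scope.

Definition dyadic : Type := seq bool.

Definition dle (s t : dyadic) : Prop := prefix s t.
Definition dlt (s t : dyadic) : Prop := dle s t /\ s <> t.

Definition minimal_elts (A : set dyadic) : set dyadic :=
  [set x | A x /\ forall y, A y -> dle y x -> y = x].

Definition subtree (T : set dyadic) : Prop :=
  (exists r, minimal_elts T = [set r]) /\
  (forall t, T t -> exists u v,
     u <> v /\ minimal_elts [set t' | T t' /\ dlt t t'] = [set u; v]).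

Definition chains (T : set dyadic) : set (set dyadic) :=
  [set b | [/\ b `<=` T, infinite_set b & total_on b dle]].

Definition maximal_chain (T b : set dyadic) : Prop :=
  chains T b /\ forall b', chains T b' -> b `<=` b' -> b' = b.

(* [e] lists the elements of [b] increasingly; every chain has exactly one
   such listing, see [chain_enum_unique] below. *)
Definition increasing_enum (b : set dyadic) (e : nat -> dyadic) : Prop :=
  range e = b /\ forall m n : nat, (m < n)%N -> dlt (e m) (e n).

Local Open Scope ring_scope.

(* The norm of C(K, X). It is defined on all functions, but [sup] is only
   meaningful on bounded ones, hence on continuous ones for compact K. *)
Definition supnorm (R : realType) (K : Type) (X : normedModType R)
    (f : K -> X) : R :=
  sup (range (fun x => `|f x|)).

(* Terms are indexed from 0. The norm is a parameter so that the definition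
   applies to C(K, X) with [supnorm]. *)
Definition unconditional (R : realType) (V : lmodType R) (N : V -> R) (C : R)
    (y : nat -> V) : Prop :=
  forall (n : nat) (a : 'I_n -> R) (A : {set 'I_n}),
    N (\sum_(i in A) a i *: y i) <= C * N (\sum_(i < n) a i *: y i).

Local Close Scope ring_scope.

Lemma dlt_size s t : dlt s t -> size s < size t.
Proof.
move=> [/prefixP[u ->]]; case: u => [|x u]; first by rewrite cats0.
by rewrite size_cat /= addnS ltnS leq_addr.
Qed.

Lemma dle_size_eq s t : dle s t -> size s = size t -> s = t.
Proof.
move=> st E; apply: contrapT => N.
by have := dlt_size (conj st N); rewrite E ltnn.
Qed.

Lemma chain_enum_unique (T b : set dyadic) :
  chains T b -> exists! e, increasing_enum b e.
Proof.
move=> [_ binf btot].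
have size_inj s t : b s -> b t -> size s = size t -> s = t.
  move=> bs bt E; case: (btot _ _ bs bt) => H; first exact: dle_size_eq.
  by apply/esym/dle_size_eq.
have lt_of s t : b s -> b t -> size s < size t -> dlt s t.
  move=> bs bt st; split; last by move=> E; rewrite E ltnn in st.
  by case: (btot _ _ bs bt) => // /size_prefix; rewrite leqNgt st.
have unbounded m : exists t, b t /\ m <= size t.
  apply: contrapT => H; apply: binf.
  rewrite -(eq_finite_set (inj_card_eq (f := size) (A := b) _)); last first.
    by move=> s t /set_mem bs /set_mem bt; exact: size_inj.
  apply: (sub_finite_set (B := `I_m)) => // _ [t bt <-] /=.
  by rewrite ltnNge; apply/negP => mt; apply: H; exists t.
have next m : exists t, [/\ b t, m <= size t &
    forall u, b u -> m <= size u -> size t <= size u].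
  have ex : exists k, `[< exists t, [/\ b t, m <= size t & size t = k] >].
    by have [t [bt mt]] := unbounded m; exists (size t); apply: asboolT; exists t.
  case: (ex_minnP ex) => k /asboolP[t [bt mt <-]] kmin.
  by exists t; split=> // u bu mu; apply: kmin; apply: asboolT; exists u.
have [g gP] := choice next.
pose fix e n := if n is k.+1 then g (size (e k)).+1 else g 0.
have be n : b (e n).
  by case: n => [|n]; [have [] := gP 0 | have [] := gP (size (e n)).+1].
have eS n : size (e n) < size (e n.+1).
  by have [] := gP (size (e n)).+1.
have elt m n : m < n -> size (e m) < size (e n).
  elim: n => // n IH; rewrite ltnS leq_eqVlt => /orP[/eqP->//|/IH H].
  exact: ltn_trans (eS n).
have en n : n <= size (e n) by elim: n => // n IH; exact: leq_ltn_trans (eS n).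
have re t : b t -> exists m, e m = t.
  move=> bt.
  have ex : exists n, size t <= size (e n) by exists (size t).
  case: (ex_minnP ex) => k tk kmin; exists k.
  apply: size_inj => //; apply/eqP; rewrite eqn_leq tk andbT.
  case: k tk kmin => [|k] tk kmin; first by have [_ _] := gP 0; apply.
  have [_ _] := gP (size (e k)).+1; apply=> //.
  by rewrite ltnNge; apply/negP => /kmin; rewrite ltnn.
exists e; split.
  split; last by move=> m n mn; apply: lt_of => //; exact: elt.
  by apply/seteqP; split=> [_ [n _ <-]//|t /re[n <-]]; exists n.
move=> e' [re' ie'].
have be' n : b (e' n) by rewrite -re'; exists n.
apply/funext => n; elim/ltn_ind: n => n IH.
apply: size_inj => //; apply/eqP; rewrite eqn_leq; apply/andP; split.
- have [m mE] := re _ (be' n); rewrite -mE.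
  have [mn|] := ltnP m n.
    by have := dlt_size (ie' _ _ mn); rewrite -(IH _ mn) mE ltnn.
  by rewrite leq_eqVlt => /orP[/eqP->//|/elt/ltnW].
- have : b (e n) by [].
  rewrite -{1}re' => -[m _ mE]; rewrite -mE.
  have [mn|] := ltnP m n.
    by have := elt _ _ mn; rewrite -mE (IH _ mn) ltnn.
  by rewrite leq_eqVlt => /orP[/eqP->//|/ie' /dlt_size/ltnW].
Qed.

(* Main.v *)
(* By a Baire argument the cardinality bound J is uniform above some node, and on
   a subtree each of the J values of f_t is either negligible (summably in the
   level) or of norm at least some delta. Colour a point of K at the node t by
   the index of the value of f_t there, negligible values being uncoloured. By
   compactness and pointwise convergence no point is coloured along a whole chain,
   and more precisely every chain has a finite part on which no point is always
   coloured. The combinatorial core is that a subtree then exists on which, for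
   each single colour i, if some point has colour i at all nodes of a subset s of a
   branch, then some point has colour i on s and no colour at the other nodes
   below a given node of that branch. Splitting a sum restricted to A according
   to the colours at a point x bounds each monochromatic part by the full sum at
   another point, so the constant is of the order of J. *)

Require Import Defs.
From HB Require Import structures.
From mathcomp Require Import all_boot all_order all_algebra.
From mathcomp Require Import all_classical all_reals all_analysis.
From mathcomp Require Import ring lra.
Import Order.TTheory GRing.Theory Num.Theory.
Import numFieldNormedType.Exports.

Set Implicit Arguments.
Unset Strict Implicit.
Unset Printing Implicit Defensive.

Local Open Scope classical_set_scope.

(** * Subtrees of the dyadic tree *)

(** Subtrees are handled as maps. The equality also keeps incomparable nodes incomparable, which
    makes the map injective and its range a subtree. *)
Definition embedding (g : dyadic -> dyadic) : Prop :=
  forall u v, prefix (g u) (g v) = prefix u v.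

Definition increasing (x : nat -> dyadic) : Prop :=
  forall n, dlt (x n) (x n.+1).

Lemma dltP u v : dlt u v <-> exists b w, v = u ++ b :: w.
Proof.
split=> [[/prefixP[[|b w] ->] neq]|[b [w ->]]].
- by case: neq; rewrite cats0.
- by exists b, w.
- split; first exact: prefix_prefix.
  by move=> /(congr1 size)/eqP; rewrite size_cat /= -{1}[size u]addn0 eqn_add2l.
Qed.

Lemma dlt_le_trans u v w : dlt u v -> dle v w -> dlt u w.
Proof.
by move=> /dltP[b [z ->]] /prefixP[z' ->]; apply/dltP; exists b, (z ++ z'); rewrite -catA.
Qed.

Lemma prefix_anti (u v : dyadic) : prefix u v -> prefix v u -> u = v.
Proof.
move=> uv vu; apply: dle_size_eq => //.
by apply/eqP; rewrite eqn_leq !size_prefix.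
Qed.

Lemma dyadic_cases (u v : dyadic) :
  [\/ prefix u v, dlt v u |
      exists p b w w', u = p ++ b :: w /\ v = p ++ ~~ b :: w'].
Proof.
elim: u v => [|a u IH] [|b v]; first by constructor 1.
- by constructor 1.
- by constructor 2; apply/dltP; exists a, u.
- have [->|ab] := eqVneq a b.
    case: (IH v) => [uv|/dltP[d [w ->]]|[p [d [w [w' [-> ->]]]]]].
    + by constructor 1; rewrite prefix_cons eqxx.
    + by constructor 2; apply/dltP; exists d, w.
    + by constructor 3; exists (b :: p), d, w, w'.
  by constructor 3; exists [::], a, u, v; case: a b ab => [] [].
Qed.

Lemma embedding_inj g u v : embedding g -> g u = g v -> u = v.
Proof. by move=> gE guv; apply: prefix_anti; rewrite -gE guv prefix_refl. Qed.

Lemma embedding_lt g u v : embedding g -> dlt (g u) (g v) <-> dlt u v.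
Proof.
move=> gE; rewrite /dlt /dle gE; split=> -[? neq]; split=> // E; apply: neq.
- by rewrite E.
- exact: embedding_inj E.
Qed.

Lemma embedding_id : embedding id. Proof. by []. Qed.

Lemma embedding_comp g h : embedding g -> embedding h -> embedding (g \o h).
Proof. by move=> gE hE u v; rewrite /= gE hE. Qed.

Lemma embedding_cat p : embedding (cat p).
Proof. by move=> u v; elim: p => //= a p IH; rewrite eqxx. Qed.

Lemma embedding_size g u : embedding g -> size u <= size (g u).
Proof.
move=> gE; elim/last_ind: u => [//|u b IH]; rewrite size_rcons.
apply: leq_ltn_trans IH _; apply: dlt_size; apply/embedding_lt => //.
by apply/dltP; exists b, [::]; rewrite cats1.
Qed.

Lemma embedding_increasing g x : embedding g -> increasing x -> increasing (g \o x).
Proof. by move=> gE xI n; apply/embedding_lt. Qed.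

Lemma increasing_lt x m n : increasing x -> m < n -> dlt (x m) (x n).
Proof.
move=> xI; elim: n => // n IH; rewrite ltnS leq_eqVlt => /orP[/eqP->//|/IH].
by move=> H; apply: dlt_le_trans H _; case: (xI n).
Qed.

Lemma increasing_size x n : increasing x -> n <= size (x n).
Proof. by move=> xI; elim: n => // n IH; exact: leq_ltn_trans IH (dlt_size (xI n)). Qed.

Lemma increasing_nseq : increasing (fun n => nseq n false).
Proof. by move=> n; apply/dltP; exists false, [::]; rewrite -addn1 nseqD. Qed.

(* A tree is grown node by node; the state at a node is a label together with a
   subtree [h] above that node, inside which all later nodes are chosen and on
   which [Inv] is maintained. *)
Lemma fusion (A : Type) (Inv : A -> (dyadic -> dyadic) -> Prop)
    (step : A -> dyadic -> A -> Prop) (a0 : A) :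
  Inv a0 id ->
  (forall a h p, embedding h -> Inv a h -> Inv a (h \o cat p)) ->
  (forall a h, embedding h -> Inv a h -> exists u h' a',
     [/\ embedding h', dlt u (h' [::]), step a (h u) a' & Inv a' (h \o h')]) ->
  exists (g : dyadic -> dyadic) (lab : dyadic -> A),
    [/\ embedding g, step a0 (g [::]) (lab [::]),
        (forall u b, step (lab u) (g (rcons u b)) (lab (rcons u b))) &
        forall u, exists h, [/\ embedding h, Inv (lab u) h &
          forall v, dlt u v -> exists w, g v = h w]].
Proof.
move=> Inv0 Inv_sub Inv_step.
pose ok (s : dyadic * (dyadic -> dyadic) * A) :=
  [/\ embedding s.1.2, Inv s.2 s.1.2 & dlt s.1.1 (s.1.2 [::])].
pose next (p : dyadic) (s s' : {s | ok s}) :=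
  step (sval s).2 (sval s').1.1 (sval s').2 /\
  (exists z k, (sval s').1.1 = (sval s).1.2 (p ++ z) /\
     (sval s').1.2 = (sval s).1.2 \o cat p \o k).
have nextP (sp : {s | ok s} * dyadic) : exists s', next sp.2 sp.1 s'.
  case: sp => -[[[e h] a] sok] p; have [/= hE hI _] := sok.
  have phE := embedding_comp hE (embedding_cat p).
  have [u [h' [a' [h'E uh' st I']]]] :=
    Inv_step a _ phE (Inv_sub _ _ _ hE hI).
  have sok' : ok (h (p ++ u), h \o cat p \o h', a').
    split=> //=; first exact: embedding_comp.
    by apply/embedding_lt => //; apply/embedding_lt => //; exact: embedding_cat.
  exists (exist _ _ sok'); split=> //=.
  by exists u, h'.
have [nx nxP] := choice nextP.
have [u0 [h0 [a1 [h0E u0h st0 I0]]]] := Inv_step a0 id embedding_id Inv0.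
have ok0 : ok (u0, h0, a1) by [].
pose F u := foldl (fun s b => nx (s, [:: b])) (exist _ _ ok0 : {s | ok s}) u.
have FS u b : F (rcons u b) = nx (F u, [:: b]) by rewrite /F foldl_rcons.
pose g u := (sval (F u)).1.1; pose H u := (sval (F u)).1.2.
pose lab u := (sval (F u)).2.
have HE u : embedding (H u) by case: (svalP (F u)).
have gH u w : dlt (g u) (H u w).
  by have [_ _ gH0] := svalP (F u); apply: dlt_le_trans gH0 _; rewrite /dle HE prefix0s.
(* Everything grown above [u] in direction [b] stays in the [b] half of [H u], so the two sides of a
   fork get incomparable images. *)
have desc u b w : (exists z, g (u ++ b :: w) = H u (b :: z)) /\
    exists k, H (u ++ b :: w) = H u \o cons b \o k.
  elim/last_ind: w => [|w d [_ [k IH]]].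
    rewrite cats1; have [_ [z [k [gz Hk]]]] := nxP (F u, [:: b]).
    by rewrite /g /H FS; split; [exists z|exists k].
  rewrite -rcons_cons -rcons_cat.
  have [_ [z [k' [gz Hk]]]] := nxP (F (u ++ b :: w), [:: d]).
  rewrite {1}/g {2}/H FS gz Hk -/(H _) IH; split; first by exists (k (d :: z)).
  by exists (k \o cons d \o k').
have gmono u v : dlt u v -> dlt (g u) (g v).
  by move=> /dltP[b [w ->]]; have [[z ->] _] := desc u b w; exact: gH.
exists g, lab; split=> //; last first.
- move=> u; exists (H u); split=> //; first by case: (svalP (F u)).
  by move=> v /dltP[b [w ->]]; have [[z ->] _] := desc u b w; exists (b :: z).
- by move=> u b; rewrite /lab /g FS; case: (nxP (F u, [:: b])).
move=> u v; case: (dyadic_cases u v) => [uv|vu|[p [b [w [w' [-> ->]]]]]].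
- rewrite uv; have [->|/eqP neq] := eqVneq u v; first exact: prefix_refl.
  by case: (gmono u v).
- rewrite [RHS]negbTE.
    apply/negbTE/negP => guv; have [gvu] := gmono _ _ vu; apply.
    exact: prefix_anti.
  by apply/negP => uv; case: vu => vu; apply; exact: prefix_anti.
- have [[z ->] _] := desc p b w; have [[z' ->] _] := desc p (~~ b) w'.
  by rewrite HE (embedding_cat p) !prefix_cons; case: b.
Qed.


(** Fusion with the level as label. The reservoirs are full cones, so density always supplies the
    next node. *)
Lemma dense_subtree (P : nat -> dyadic -> Prop) :
  (forall n r, exists v, P n (r ++ v)) ->
  exists g, embedding g /\ forall u, P (size u) (g u).
Proof.
move=> dense.
have [||n h hE [r ->]|g [lab [gE [P0 l0] gS _]]] :=
    @fusion nat (fun _ h => exists r, h = cat r)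
      (fun n t n' => P n t /\ n' = n.+1) 0.
- by exists [::].
- move=> n h p _ [r ->]; exists (r ++ p); apply/funext => v /=.
  by rewrite catA.
(* The extra letter puts the new reservoir strictly above the chosen node. *)
- have [v Pv] := dense n r; exists v, (cat (rcons v false)), n.+1; split=> //.
  + exact: embedding_cat.
  + by rewrite cats0 -cats1; apply/dltP; exists false, [::].
  + by exists (r ++ rcons v false); apply/funext => w /=; rewrite catA.
exists g; split=> // u.
suff : lab u = (size u).+1 /\ P (size u) (g u) by case.
elim/last_ind: u => [//|u b [IH _]].
by have [Pub ->] := gS u b; rewrite size_rcons -IH.
Qed.

(** Induction on the colours: either the first one is absent from a cone, leaving fewer colours
    there, or it is dense and fills a subtree. *)
Lemma monochromatic_subtree (C : eqType) (l : seq C) (col : dyadic -> C) :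
  (forall u, col u \in l) ->
  exists g c, embedding g /\ forall u, col (g u) = c.
Proof.
elim: l col => [|a l IH] col; first by move=> /(_ [::]).
move=> coll; have [[r rP]|dense] :=
    pselect (exists r, forall v, col (r ++ v) <> a).
  have [v|g [c [gE gc]]] := IH (col \o cat r).
    by have := coll (r ++ v); rewrite inE => /orP[/eqP/rP|].
  exists (cat r \o g), c; split=> //.
  by apply: embedding_comp => //; exact: embedding_cat.
have [_ r|g [gE ga]] := @dense_subtree (fun _ u => col u = a).
  apply: contrapT => H; apply: dense; exists r => v va.
  by apply: H; exists v.
by exists g, a.
Qed.

(** * Monochromatic patterns *)

Section monochromatic_patterns.
Context (Y : Type) (I : finType) (c : dyadic -> Y -> option I).

Definition feasible (i : I) (s : seq dyadic) : Prop :=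
  exists y, forall t, t \in s -> c t y = Some i.

(* [(s, z, i)] asks for a point that has colour [i] on [s] and no colour on [z]. *)
Definition requirement := (seq dyadic * seq dyadic * I)%type.

(* Insisting on colour [i] along the longest feasible initial segment of [s ++ x],
   rather than on [s] only, is what lets the first node of [x] be moved into [s]
   in [realised_extend_hit]. *)
Definition realised (q : requirement) (x : nat -> dyadic) : Prop :=
  exists y, (forall m, m \in q.1.2 -> c m y = None) /\
    forall k, feasible q.2 (q.1.1 ++ mkseq x k) ->
      forall t, t \in q.1.1 ++ mkseq x k -> c t y = Some q.2.

(** Quantifying over all further subtrees makes the notion hereditary; a single subtree without a
    realising sequence refutes it. *)
Definition good (q : requirement) (h : dyadic -> dyadic) : Prop :=
  forall h', embedding h' ->
    exists2 x, increasing x & realised q (h \o h' \o x).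

Definition extend (q : requirement) (t : dyadic) (hit : bool) : requirement :=
  if hit then (rcons q.1.1 t, q.1.2, q.2) else (q.1.1, t :: q.1.2, q.2).

Lemma good_comp q h h' : embedding h' -> good q h -> good q (h \o h').
Proof. by move=> h'E qh k kE; apply: (qh (h' \o k)); exact: embedding_comp. Qed.

Lemma realised_extend_hit q x :
  realised q x -> realised (extend q (x 0) true) (x \o S).
Proof.
move=> [y [yz ys]]; exists y; split=> //= k.
have -> : rcons q.1.1 (x 0) ++ mkseq (x \o S) k = q.1.1 ++ mkseq x k.+1.
  by rewrite cat_rcons /mkseq /= (iotaDl 1 0 k : iota 1 k = _) -map_comp.
exact: ys.
Qed.

Context (chain_null : forall e, increasing e ->
  exists k, forall y, exists2 j, j < k & c (e j) y = None).

(* Otherwise fusion and the pigeonhole principle give a subtree in which one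
   requirement and one mode of extension fail at every node. Failure of hitting
   contradicts goodness on that subtree; if setting [t] to zero always fails,
   every witness is nonzero at all earlier nodes of the chain. *)
Lemma good_step (Q : seq requirement) h : embedding h ->
  (forall q, q \in Q -> good q h) ->
  exists u h', [/\ embedding h', dlt u (h' [::]) &
    forall q hit, q \in Q -> good (extend q (h u) hit) (h \o h')].
Proof.
move=> hE Qgood; apply: contrapT => fail.
pose bad (q : requirement) hit t g :=
  forall x, increasing x -> ~ realised (extend q t hit) (g \o x).
pose L := [seq (q, b) | q <- Q, b <- [:: true; false]].
have fail' u h' : embedding h' -> dlt u (h' [::]) ->
    exists (qb : requirement * bool) k, [/\ qb \in L, embedding k & bad qb.1 qb.2 (h u) (h \o h' \o k)].
  move=> h'E uh'; apply: contrapT => H; apply: fail; exists u, h'; split=> //.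
  move=> q b qQ k kE; apply: contrapT => H'; apply: H; exists (q, b), k; split=> //.
    by apply/allpairsP; exists (q, b); split=> //; case: b {H'}.
  by move=> x xI xq; apply: H'; exists x.
(* The label stores the node with a pair failing there; the reservoir is a subtree along whose every
   increasing sequence that pair fails. *)
have [||a k kE _|g [lab [gE g0 gS gbad]]] :=
    @fusion (option (dyadic * (requirement * bool)))
      (fun a g => embedding g /\
         forall t qb, a = Some (t, qb) -> qb \in L /\ bad qb.1 qb.2 (h t) (h \o g))
      (fun _ t a => exists qb, a = Some (t, qb)) None.
- by [].
- move=> a k p kE [_ ka]; split.
    by apply: embedding_comp => //; exact: embedding_cat.
  move=> t qb /ka[qL kbad]; split=> // x xI.
  apply: (kbad (cat p \o x)); apply: embedding_increasing => //.
  exact: embedding_cat.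
- have cE := embedding_comp kE (embedding_cat [:: false]).
  have [|[q b] [k' [qL k'E kbad]]] := fail' (k [::]) _ cE.
    by apply/embedding_lt => //; apply/dltP; exists false, [::].
  exists [::], (cat [:: false] \o k'), (Some (k [::], (q, b))); split=> //.
    by exists (q, b).
  by split=> [|t qb [<- <-]]; first exact: embedding_comp cE k'E.
have labE u : exists2 qb, qb \in L & lab u = Some (g u, qb).
  have [k [_ [_ gu] _]] := gbad u.
  have [qb labu] : exists qb, lab u = Some (g u, qb).
    by case/lastP: u {gu} => [|u b]; [exact: g0|exact: gS].
  by exists qb => //; have [] := gu _ _ labu.
have [|g' [[q hit] [g'E colE]]] :=
    @monochromatic_subtree _ L (fun u => (projT1 (cid2 (labE u)))).
  by move=> u; case: (cid2 (labE u)).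
have gg'E := embedding_comp gE g'E.
(* All nodes above [g (g' u)] lie in the reservoir on which the pair stored at that node fails, and
   by the choice of [g'] this pair is always [(q, hit)]. *)
have Ebad u x : increasing x -> dlt u (x 0) ->
    ~ realised (extend q (h (g (g' u))) hit) (h \o (g \o g') \o x).
  move=> xI ux; have [k [_ [kE gu] gk]] := gbad (g' u).
  have := colE u; case: (cid2 (labE (g' u))) => qb /= qL /gu[_ kbad] qbE.
  rewrite {}qbE in kbad.
  have ux' n : dlt (g' u) (g' (x n)).
    apply/(embedding_lt _ _ g'E); case: n => // n.
    by have [x0n _] := increasing_lt xI (ltn0Sn n); exact: dlt_le_trans ux x0n.
  have [w wE] := choice (fun n => gk _ (ux' n)).
  suff -> : h \o (g \o g') \o x = h \o k \o w.
    apply: kbad => n; apply/(embedding_lt _ _ kE); rewrite -!wE.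
    exact: (embedding_increasing gg'E xI n).
  by apply/funext => n /=; rewrite wE.
have qQ : q \in Q.
  have := colE [::]; case: (cid2 (labE _)) => qb /= + _ qbE.
  by rewrite qbE => /allpairsP[[q' b] [q'Q _ [-> _]]].
case: hit Ebad {colE} => Ebad.
  have [x xI xq] := Qgood q qQ _ gg'E.
  apply: (Ebad (x 0) (x \o S)) => //; first by move=> n; exact: xI.
  exact: realised_extend_hit xq.
(* A witness for [q] along a sequence above [nseq k false] has no colour at some earlier
   [nseq j false], so it also realises the extension by a zero there. *)
have [k kP] := chain_null
  (embedding_increasing hE (embedding_increasing gg'E increasing_nseq)).
have [x xI [y [yz ys]]] :=
  Qgood q qQ _ (embedding_comp gg'E (embedding_cat (nseq k false))).
have [j jk yj] := kP y.
apply: (Ebad (nseq j false) (cat (nseq k false) \o x)).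
- by apply: embedding_increasing => //; exact: embedding_cat.
- apply: dlt_le_trans (increasing_lt increasing_nseq jk) _.
  exact: prefix_prefix.
- exists y; split=> //= m; rewrite inE => /orP[/eqP->//|]; exact: yz.
Qed.

(** By [chain_null] the feasible initial segments of a sequence have bounded length; a witness for
    the longest one serves them all. *)
Lemma good_initial (y0 : Y) i : good ([::], [::], i) id.
Proof.
move=> h hE; have xI := embedding_increasing hE increasing_nseq.
exists (fun n => nseq n false); first exact: increasing_nseq.
have [k kP] := chain_null xI.
set x := id \o h \o _; pose F n := feasible i (mkseq x n).
have ex : exists n, `[< F n >].
  by exists 0; apply/asboolP; exists y0.
have F_le n : `[< F n >] -> n <= k.
  move=> /asboolP[y yi]; rewrite leqNgt; apply/negP => kn.
  have [j jk] := kP y; rewrite yi //; apply/mapP; exists j => //.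
  by rewrite mem_iota (ltn_trans jk).
have [n /asboolP[y yi] nmax] := ex_maxnP ex F_le.
exists y; split=> //= m mF t /mapP[j]; rewrite mem_iota /= => jm ->.
apply: yi; apply/mapP; exists j => //; rewrite mem_iota /=.
by apply: leq_trans jm _; apply: nmax; apply/asboolP.
Qed.

(** The fusion label at a node lists requirements for every colour and every way to split the nodes
    up to it into hits and zeros, all kept good by [good_step]. The one that matches [A] and [i]
    gives the point. *)
Lemma monochromatic_hereditary (y0 : Y) : exists g, embedding g /\
  forall u (A : pred nat) i,
    (exists y, forall k, k <= size u -> A k -> c (g (take k u)) y = Some i) ->
    exists y, forall k, k <= size u ->
      c (g (take k u)) y = if A k then Some i else None.
Proof.
pose a0 : seq requirement := [seq ([::], [::], i) | i <- enum I].
have [||Q h hE Qh|g [lab [gE g0 gS glab]]] :=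
    @fusion (seq requirement) (fun Q h => forall q, q \in Q -> good q h)
      (fun Q t Q' => Q' = [seq extend q t b | q <- Q, b <- [:: true; false]]) a0.
- by move=> q /mapP[i _ ->]; exact: good_initial.
- move=> Q h p hE Qh q /Qh; apply: good_comp; exact: embedding_cat.
- have [u [h' [h'E uh' Qh']]] := good_step hE Qh.
  exists u, h', [seq extend q (h u) b | q <- Q, b <- [:: true; false]].
  split=> // _ /allpairsP[[q b] [qQ _ ->]]; exact: Qh'.
exists g; split=> // u A i [y yA].
pose tracks (q : requirement) v n := [/\ q.2 = i,
  forall t, t \in q.1.1 -> exists2 k, k < n /\ A k & t = g (take k v),
  forall k, k < n -> A k -> g (take k v) \in q.1.1 &
  forall k, k < n -> ~~ A k -> g (take k v) \in q.1.2].
have tracksS q v : tracks q v (size v) ->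
    tracks (extend q (g v) (A (size v))) v (size v).+1.
  move=> [qi qs qA qz]; split.
  - by case: (A _).
  - have qs' t : t \in q.1.1 -> exists2 k, k < (size v).+1 /\ A k & t = g (take k v).
      by move=> /qs[k [kv Ak] ->]; exists k => //; split=> //; exact: leqW.
    case: (boolP (A _)) => Av t /=; last exact: qs'.
    rewrite mem_rcons inE => /orP[/eqP->|/qs'//].
    by exists (size v); rewrite ?take_size.
  - move=> k; rewrite ltnS leq_eqVlt => /orP[/eqP->{k} Av|kv Ak].
      by rewrite Av /= take_size mem_rcons mem_head.
    by case: (A _) => /=; rewrite ?mem_rcons ?inE qA ?orbT.
  - move=> k; rewrite ltnS leq_eqVlt => /orP[/eqP->{k} /negbTE Av|kv Ak].
      by rewrite Av /= take_size mem_head.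
    by case: (A _) => /=; rewrite ?inE qz ?orbT.
have in_extend Q q t b : q \in Q ->
    extend q t b \in [seq extend q t b | q <- Q, b <- [:: true; false]].
  by move=> qQ; apply/allpairsP; exists (q, b); split=> //; case: b.
have {tracksS} [q qu [qi qs qA qz]] : exists2 q, q \in lab u & tracks q u (size u).+1.
  elim/last_ind: u {yA} => [|u b [q qu [qi qs qA qz]]].
    exists (extend ([::], [::], i) (g [::]) (A 0)); last exact: tracksS.
    by rewrite g0; apply/in_extend/map_f; rewrite mem_enum.
  exists (extend q (g (rcons u b)) (A (size (rcons u b)))).
    by rewrite gS; exact: in_extend.
  have takeE k : k <= size u -> take k (rcons u b) = take k u.
    by move=> ku; rewrite -cats1 takel_cat.
  apply: tracksS; rewrite size_rcons; split=> // [t /qs[k [ku Ak] ->]|k ku|k ku].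
  - by exists k => //; rewrite takeE.
  - by rewrite takeE //; exact: qA.
  - by rewrite takeE //; exact: qz.
have [h [hE labh _]] := glab u.
have [x _ [z [zn zi]]] := labh _ qu _ embedding_id.
exists z => k ku; case: ifP => Ak; last by apply: zn; apply: qz => //; rewrite Ak.
(* With the empty continuation, feasibility is exactly the existence of the given [y]. *)
have := zi 0; rewrite cats0 qi; apply; last exact: qA.
by exists y => t /qs[k' [k'u Ak'] ->]; exact: yA.
Qed.
End monochromatic_patterns.

(** * Chains and branches *)

Lemma subtree_range g : embedding g -> subtree (range g).
Proof.
move=> gE; split.
  exists (g [::]); apply/seteqP; split=> [_ [[u _ <-] umin]|_ ->].
    by apply/esym/umin; [exists [::]|rewrite /dle gE prefix0s].
  split; first by exists [::].
  by move=> _ [v _ <-]; rewrite /dle gE prefixs0 => /eqP ->.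
move=> _ [u _ <-]; exists (g (rcons u true)), (g (rcons u false)); split.
  by move=> /(embedding_inj gE)/rcons_inj.
have lt_rcons b : dlt u (rcons u b) by apply/dltP; exists b, [::]; rewrite cats1.
have above v : dlt u v -> exists b, prefix (rcons u b) v.
  by move=> /dltP[b [w ->]]; exists b; rewrite -cat_rcons prefix_prefix.
apply/seteqP; split=> [_ [[[v _ <-] /(embedding_lt _ _ gE)/above[b bv]] vmin]|t].
  have -> : g v = g (rcons u b).
    apply/esym/vmin; last by rewrite /dle gE.
    by split; [exists (rcons u b)|apply/embedding_lt].
  by case: b {bv}; [left|right].
move=> tE; have [b ->] : exists b, t = g (rcons u b).
  by case: tE => ->; [exists true|exists false].
split; first by split; [exists (rcons u b)|apply/embedding_lt].
move=> _ [[v _ <-] /(embedding_lt _ _ gE)/above[b' b'v]].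
rewrite /dle gE => vb; congr g; apply: prefix_anti => //.
have := prefix_trans b'v vb.
rewrite prefixE !size_rcons take_oversize ?size_rcons // => /eqP/rcons_inj[bb].
by rewrite bb.
Qed.

Lemma subtree_chain_enum g b e : embedding g -> chains (range g) b ->
  increasing_enum b e -> exists2 w, increasing w & e = g \o w.
Proof.
move=> gE [bg _ _] [be einc].
have wP n : exists u, g u = e n.
  have : b (e n) by rewrite -be; exists n.
  by move=> /bg[u _ <-]; exists u.
have [w wE] := choice wP; exists w.
  by move=> n; apply/(embedding_lt _ _ gE); rewrite !wE; exact: einc.
by apply/funext => n /=; rewrite wE.
Qed.

(** For increasing [e] the length of [e n] is at least [n], so this lists, level by level, the
    maximal chain through [e]. *)
Definition branch (e : nat -> dyadic) (n : nat) : dyadic := take n (e n).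

Section branch.
Context (e : nat -> dyadic) (eI : increasing e).

Lemma size_branch n : size (branch e n) = n.
Proof. by rewrite size_takel // increasing_size. Qed.

Lemma branchE m n : m <= n -> branch e m = take m (branch e n).
Proof.
move=> mn; rewrite /branch take_takel //.
have /prefixP[w ->] : prefix (e m) (e n).
  move: mn; rewrite leq_eqVlt => /orP[/eqP->|/(increasing_lt eI)[]//].
  exact: prefix_refl.
by rewrite takel_cat // increasing_size.
Qed.

Lemma branch_size n : branch e (size (e n)) = e n.
Proof.
rewrite /branch.
have /prefixP[w ->] : prefix (e n) (e (size (e n))); last by rewrite take_size_cat.
have := increasing_size n eI; rewrite leq_eqVlt => /orP[/eqP <-|/(increasing_lt eI)[]//].
exact: prefix_refl.
Qed.

Lemma branch_lt m n : m < n -> dlt (branch e m) (branch e n).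
Proof.
move=> mn; split; first by rewrite (branchE (ltnW mn)) /dle prefix_take.
by move=> /(congr1 size); rewrite !size_branch => E; rewrite E ltnn in mn.
Qed.

Lemma branch_maximal : maximal_chain [set: dyadic] (range (branch e)).
Proof.
have bI : injective (branch e) by move=> m n /(congr1 size); rewrite !size_branch.
have inf : infinite_set (range (branch e)).
  move=> fin; apply: (@infinite_nat).
  rewrite -(eq_finite_set (inj_card_eq (f := branch e) (A := [set: nat]) _)) //.
  by move=> m n _ _; exact: bI.
split; first split=> // _ _ [m _ <-] [n _ <-].
  case: (leqP m n) => [mn|/ltnW mn]; [left|right];
  by rewrite (branchE mn) /dle prefix_take.
move=> b [_ _ btot] sub; apply/seteqP; split=> // t bt.
exists (size t) => //.
have bs : b (branch e (size t)) by apply: sub; exists (size t).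
have := size_branch (size t).
case: (btot _ _ bt bs) => [H E|H E]; last exact: dle_size_eq.
by apply/esym/dle_size_eq.
Qed.

End branch.

Local Open Scope ring_scope.

(** * Compactness of [K] and the supremum norm *)

(** A cluster point of the witnesses works, since [A j] contains all of them from index [j.+1]
    on. *)
Lemma compact_closed_seq (K : topologicalType) (A : nat -> set K) :
  compact [set: K] -> (forall j, closed (A j)) ->
  (forall k, exists y, forall j, (j < k)%N -> A j y) ->
  exists y, forall j, A j y.
Proof.
move=> Kc Acl /choice[y yA].
have [p [_ pcl]] : [set: K] `&` cluster (y @ \oo) !=set0.
  by apply: Kc; exact: filterT.
exists p => j; apply: Acl => B Bp; apply: pcl => //.
by exists j.+1 => // n /= jn; exact: yA.
Qed.

Lemma le_supnorm (R : realType) (K : topologicalType) (X : normedModType R)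
    (f : K -> X) : compact [set: K] -> continuous f ->
  forall x, `|f x| <= supnorm f.
Proof.
move=> Kc fc x; apply: ub_le_sup; last by exists x.
have /compact_bounded[M [_ Mb]] : compact (f @` [set: K]).
  by apply: continuous_compact => //; exact: continuous_subspaceT.
exists (M + 1) => _ [y _ <-]; apply: (Mb (M + 1)); first by rewrite ltrDl.
by exists y.
Qed.

(** * Norm estimates *)

Section pattern_estimate.
Context (R : realType) (X : normedModType R) (K : Type) (I : finType) (n : nat).
Context (F : 'I_n -> K -> X) (col : 'I_n -> K -> option I).
Context (val : 'I_n -> I -> X) (eps : 'I_n -> R).
Context (col_Some : forall j x i, col j x = Some i -> F j x = val j i).
Context (col_None : forall j x, col j x = None -> `|F j x| <= eps j).
Context (eps_ge0 : forall j, 0 <= eps j).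
Context (eps_sum : \sum_j eps j <= 4^-1).
Context (F_large : forall j, exists x, 2^-1 < `|F j x|).
Context (patterns : forall (B : {set 'I_n}) i,
  (exists x, forall j, j \in B -> col j x = Some i) ->
  exists y, forall j, col j y = if j \in B then Some i else None).
Context (a : 'I_n -> R) (N : R).
Context (N_bound : forall x, `|\sum_j a j *: F j x| <= N).

Lemma small_sum_bound (P : pred 'I_n) x M : 0 <= M ->
  (forall j, `|a j| <= M) -> (forall j, P j -> col j x = None) ->
  `|\sum_(j | P j) a j *: F j x| <= M / 4.
Proof.
move=> M0 aM Pnone; apply: le_trans (ler_norm_sum _ _ _) _.
apply: (@le_trans _ _ (M * \sum_j eps j)).
  rewrite mulr_sumr big_mkcond /=; apply: ler_sum => j _.
  case: ifP => [/Pnone/col_None Fj|_]; last exact: mulr_ge0.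
  by rewrite normrZ ler_pM.
exact: ler_wpM2l.
Qed.

(** At the point [y] with pattern exactly [B], the functions indexed by [B] take the same values as
    at [x] and the others are small, so the full sum at [y] nearly equals the partial sum at [x]. *)
Lemma pattern_sum_bound (B : {set 'I_n}) i x M : 0 <= M -> (forall j, `|a j| <= M) ->
  (forall j, j \in B -> col j x = Some i) ->
  `|\sum_(j in B) a j *: F j x| <= N + M / 4.
Proof.
move=> M0 aM Bi; have [y yB] := patterns (ex_intro _ x Bi).
have -> : \sum_(j in B) a j *: F j x =
    \sum_j a j *: F j y - \sum_(j | j \notin B) a j *: F j y.
  rewrite (bigID (mem B) xpredT) /= addrK; apply: eq_bigr => j jB.
  by rewrite (col_Some (Bi j jB)) (@col_Some _ _ i) // yB jB.
apply: le_trans (ler_normB _ _) _; apply: lerD; first exact: N_bound.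
by apply: small_sum_bound => // j /negbTE jB; rewrite yB jB.
Qed.

(** Let M be the largest modulus of a coefficient. Where its function exceeds 1/2 it is coloured, as
    [eps] is at most 1/4, and the singleton pattern gives M/2 <= N + M/4. *)
Lemma coefficient_bound j : `|a j| <= 4 * N.
Proof.
case: (@arg_maxP _ _ _ j xpredT (fun j => `|a j|) erefl) => j0 _ amax.
have aM k : `|a k| <= `|a j0| by exact: amax.
apply: le_trans (aM j) _; have [x xF] := F_large j0.
have e0 : eps j0 <= 4^-1.
  by apply: le_trans eps_sum; rewrite (bigD1 j0) //= lerDl sumr_ge0.
case E : (col j0 x) => [i|]; last by have := col_None E; lra.
have := @pattern_sum_bound [set j0] i x _ (normr_ge0 _) aM.
rewrite big_set1 normrZ => /(_ _)/wrap[j' /set1P->//|H].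
have := normr_ge0 (a j0); nra.
Qed.

Lemma restricted_sum_bound (A : {set 'I_n}) x :
  `|\sum_(j in A) a j *: F j x| <= 2 * (#|I|.+1)%:R * N.
Proof.
have aM := coefficient_bound.
rewrite (partition_big (fun j => col j x) xpredT) //=.
apply: le_trans (ler_norm_sum _ _ _) _.
(* One share per colour class at [x]: a colour costs N + 4N/4, and the uncoloured class 4N/4. *)
have -> : 2 * (#|I|.+1)%:R * N = \sum_(o : option I) (2 * N).
  by rewrite sumr_const card_option -[RHS]mulr_natr mulrAC.
have N0 : 0 <= N by apply: le_trans (N_bound x).
have N4 : 0 <= 4 * N by exact: mulr_ge0.
apply: ler_sum => -[i|] _.
  pose B := [set j in A | col j x == Some i].
  have -> : \sum_(j in A | col j x == Some i) a j *: F j x = \sum_(j in B) a j *: F j x.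
    by apply: eq_bigl => j; rewrite inE.
  have := @pattern_sum_bound B i x _ N4 aM.
  move=> /(_ _)/wrap[j|]; last lra.
  by rewrite inE => /andP[_ /eqP].
have := @small_sum_bound (fun j => (j \in A) && (col j x == None)) x _ N4 aM.
move=> /(_ _)/wrap[j /andP[_ /eqP]//|]; lra.
Qed.

End pattern_estimate.

(** * Smallness, cardinality and thin values of the family *)

(** Convergence is assumed on maximal chains only; [e n] sits at index [size (e n)], at least [n],
    of the one through [e]. *)
Lemma increasing_small (R : realType) (X : normedModType R) (K : Type)
    (f : dyadic -> K -> X) :
  (forall b, maximal_chain [set: dyadic] b -> forall e, increasing_enum b e ->
     forall x, (fun n => f (e n) x) @ \oo --> (0 : X)) ->
  forall e x (delta : R), increasing e -> 0 < delta ->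
    exists n, `|f (e n) x| < delta.
Proof.
move=> f0 e x delta eI d0.
have enum : increasing_enum (range (branch e)) (branch e).
  by split=> // m n; exact: branch_lt.
have [N _ NP] := cvgr0_norm_lt _ (f0 _ (branch_maximal eI) _ enum x) _ d0.
exists N; rewrite -(branch_size eI N); apply: NP.
exact: increasing_size.
Qed.

(** Otherwise every bound is violated above every node, and one builds a chain whose node number n
    violates the bound n; the maximal chain through it has no bound. *)
Lemma uniform_card_cone (K X : Type) (f : dyadic -> K -> X) :
  (forall b, maximal_chain [set: dyadic] b -> exists J : nat,
     forall s, b s -> (range (f s) #<= `I_J)%card) ->
  exists r (J : nat), forall v, (range (f (r ++ v)) #<= `I_J)%card.
Proof.
move=> fJ; apply: contrapT => H.
have big (rJ : dyadic * nat) :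
    exists v, ~ (range (f (rJ.1 ++ v)) #<= `I_(rJ.2))%card.
  apply: contrapT => Hv; apply: H; exists rJ.1, rJ.2 => v.
  by apply: contrapT => Hc; apply: Hv; exists v.
have [F FP] := choice big.
pose fix e n : dyadic := if n is m.+1
  then rcons (e m) false ++ F (rcons (e m) false, n) else F ([::], 0%N).
have eI : increasing e.
  move=> n; apply/dltP; exists false, (F (rcons (e n) false, n.+1)).
  by rewrite -cat_rcons.
have [J JP] := fJ _ (branch_maximal eI).
have : ~ (range (f (e J)) #<= `I_J)%card.
  by case: J {JP} => [|J]; [exact: (FP ([::], 0%N))|
    exact: (FP (rcons (e J) false, J.+1))].
by apply; apply: JP; exists (size (e J)) => //; exact: branch_size.
Qed.

(** Treat the indices one by one: either a value is bounded below on a cone, or its small values are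
    dense and [dense_subtree] applies. Earlier alternatives survive because levels only grow and
    [eps] decreases. *)
Lemma thin_values (R : realType) (I : finType) (v : dyadic -> I -> R)
    (eps : nat -> R) :
  (forall n, 0 < eps n) -> (forall m n, (m <= n)%N -> eps n <= eps m) ->
  exists g delta, [/\ embedding g, 0 < delta & forall i,
    (forall u, v (g u) i <= eps (size u)) \/ (forall u, delta <= v (g u) i)].
Proof.
move=> eps0 epsD.
suff /(_ (enum I))[g [delta [gE d0 gP]]] : forall l : seq I,
    exists g delta, [/\ embedding g, 0 < delta & forall i, i \in l ->
    (forall u, v (g u) i <= eps (size u)) \/ (forall u, delta <= v (g u) i)].
  by exists g, delta; split=> // i; apply: gP; rewrite mem_enum.
elim=> [|i l [g [delta [gE d0 gP]]]]; first by exists id, 1.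
have [[r [d [d_gt0 rP]]]|small] :=
    pselect (exists r d, 0 < d /\ forall w, d <= v (g (r ++ w)) i).
  exists (g \o cat r), (Num.min d delta); split.
  - by apply: embedding_comp => //; exact: embedding_cat.
  - by rewrite lt_min d_gt0.
  - move=> j; rewrite inE => /orP[/eqP->|/gP[jl|jl]]; [right|left|right] => u /=.
    + by rewrite ge_min rP.
    + by apply: le_trans (jl _) _; apply: epsD; rewrite size_cat leq_addl.
    + by rewrite ge_min jl orbT.
have [n r|h [hE hP]] := @dense_subtree (fun n u => v (g u) i <= eps n).
  apply: contrapT => H; apply: small; exists r, (eps n); split=> // w.
  by rewrite leNgt; apply/negP => /ltW wi; apply: H; exists w.
exists (g \o h), delta; split=> //; first exact: embedding_comp.
move=> j; rewrite inE => /orP[/eqP->|/gP[jl|jl]]; [left|left|right] => u //=.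
by apply: le_trans (jl _) _; apply: epsD; exact: embedding_size.
Qed.

Lemma enumerate_range (K : Type) (X : pointedType) (f : K -> X) (J : nat) :
  (range f #<= `I_J)%card -> exists h : 'I_J -> X, forall x, exists j, f x = h j.
Proof.
move=> /pcard_surjP[h hP]; exists (fun j => h j) => x.
have [|k kJ <-] := hP (f x); first by exists x.
by exists (Ordinal kJ).
Qed.

Lemma geometric_sum_le (R : realType) n :
  \sum_(j < n) (2^-1 : R) ^+ (j + 3) <= 4^-1.
Proof.
suff -> : \sum_(j < n) (2^-1 : R) ^+ (j + 3) = 4^-1 - 2^-1 ^+ (n + 2).
  by rewrite gerBl exprn_ge0.
elim: n => [|n IH]; first by rewrite big_ord0; field.
by rewrite big_ord_recr /= IH !addnS !addn0 !exprS; field.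
Qed.

(** * Colouring by values and the final assembly *)

Lemma unconditional_family (R : realType) (K : topologicalType)
    (X : normedModType R) (f : dyadic -> K -> X) (J : nat) :
  compact [set: K] -> (forall s, continuous (f s)) ->
  (forall s, supnorm (f s) = 1) ->
  (forall e x (delta : R), increasing e -> 0 < delta ->
     exists n, `|f (e n) x| < delta) ->
  (forall s, (range (f s) #<= `I_J)%card) ->
  exists g, embedding g /\ forall w, increasing w ->
    unconditional (@supnorm R K X) (2 * (J.+1)%:R) (fun n => f (g (w n))).
Proof.
move=> Kc fc f1 f0 fJ.
have [x0 _] : [set: K] !=set0.
  apply: contrapT => /set0P/negP; rewrite negbK => /eqP K0.
  by have := f1 [::]; rewrite /supnorm K0 image_set0 sup0 => /eqP;
    rewrite eq_sym oner_eq0.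
have [h hP] := choice (fun s => enumerate_range (fJ s)).
(* The shift by 3 makes the total at most 1/4, as [pattern_estimate] requires. *)
pose eps n : R := 2^-1 ^+ (n + 3).
have eps_gt0 n : 0 < eps n by rewrite exprn_gt0.
have epsD m n : (m <= n)%N -> eps n <= eps m.
  by move=> mn; apply: ler_wiXn2l; rewrite ?leq_add2r //; lra.
have [g [delta [gE delta0 gP]]] := thin_values (fun s j => `|h s j|) eps_gt0 epsD.
pose col u x : option 'I_J :=
  [pick j | (h (g u) j == f (g u) x) && (eps (size u) < `|h (g u) j|)].
have col_Some u x j : col u x = Some j -> f (g u) x = h (g u) j.
  by rewrite /col; case: pickP => // k /andP[/eqP <- _] [->].
have col_None u x : col u x = None -> `|f (g u) x| <= eps (size u).
  rewrite /col; case: pickP => // H _; have [j fj] := hP (g u) x.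
  by have := H j; rewrite -fj eqxx /= => /negbT; rewrite -leNgt.
have col_delta u x : col u x <> None -> delta <= `|f (g u) x|.
  rewrite /col; case: pickP => // j /andP[/eqP <- jeps] _.
  by case: (gP j) => [/(_ u)|//]; rewrite leNgt jeps.
(* Otherwise compactness yields a point where the norms stay at least [delta] along all of [e],
   against pointwise convergence. *)
have col_null e : increasing e ->
    exists k, forall y, exists2 j, (j < k)%N & col (e j) y = None.
  move=> eI; apply: contrapT => H.
  have [|k|y yP] := @compact_closed_seq K
      (fun j => [set y | delta <= `|f (g (e j)) y|]) Kc.
  - move=> j; apply: (@closed_comp _ _ (fun y => `|f (g (e j)) y|) [set r | delta <= r]).
      by move=> y _; apply: cvg_norm; exact: fc.
    exact: closed_ge.
  - apply: contrapT => Hk; apply: H; exists k => y.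
    apply: contrapT => Hy; apply: Hk; exists y => j jk /=.
    by apply: col_delta => cj; apply: Hy; exists j.
  have [n] := f0 _ y _ (embedding_increasing gE eI) delta0.
  by rewrite ltNge yP.
have [g' [g'E g'P]] := monochromatic_hereditary col_null x0.
exists (g \o g'); split; first exact: embedding_comp.
move=> w wI n a A.
have sum_fc (P : pred 'I_n) :
    continuous (\sum_(i | P i) a i *: f (g (g' (w i)))).
  apply: (big_ind (fun u : K -> X => continuous u)).
  - by move=> x; exact: cst_continuous.
  - by move=> u v uc vc x; apply: continuousD; [exact: uc|exact: vc].
  - by move=> i _ x; apply: continuousZl_tmp; exact: fc.
have sumE (P : pred 'I_n) x :
    (\sum_(i | P i) a i *: f (g (g' (w i)))) x = \sum_(i | P i) a i *: f (g (g' (w i))) x.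
  by rewrite fct_sumE.
apply: ge_sup; first by exists `|(\sum_(i in A) a i *: f (g (g' (w i)))) x0|, x0.
move=> _ [x _ <-]; rewrite sumE -[in (2 * _)](card_ord J).
apply: (@restricted_sum_bound R X K _ n (fun i => f (g (g' (w i))))
  (fun i => col (g' (w i))) (fun i => h (g (g' (w i)))) (fun i => eps i)).
- by move=> j y i; exact: col_Some.
- move=> j y /col_None H; apply: le_trans H _; apply: epsD.
  exact: increasing_size (embedding_increasing g'E wI).
- by move=> j; exact: ltW.
- exact: geometric_sum_le.
- move=> j; have [||_ [y _ <-] H] :=
    @sup_gt R (range (fun x => `|f (g (g' (w j))) x|)) 2^-1.
  + by exists `|f (g (g' (w j))) x0|, x0.
  + by have := f1 (g (g' (w j))); rewrite /supnorm => ->; lra.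
  + by exists y.
- move=> B i [y yB]; case: n a A B y yB {sum_fc sumE} => [|n] a A B y yB.
    by exists y => -[].
  pose top := w n.
  have topE (j : 'I_n.+1) : w j = take (size (w j)) top.
    rewrite /top; have := ltn_ord j; rewrite ltnS leq_eqVlt => /orP[/eqP->|jn].
      by rewrite take_size.
    by have [+ _] := increasing_lt wI jn; rewrite /dle prefixE => /eqP/esym.
  have size_le (j : 'I_n.+1) : (size (w j) <= size top)%N.
    by rewrite (topE j) size_take; case: ltnP => // /ltnW.
  (* [g'P] prescribes every level up to [top]; those of the [w j] with [j] in [B] are marked, and
     distinct [j] occupy distinct levels. *)
  pose S k := [exists j in B, size (w j) == k].
  have [|z zP] := g'P top S i.
    exists y => k _ /existsP[j /andP[jB /eqP <-]]; rewrite -topE; exact: yB.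
  exists z => j; rewrite [in LHS](topE j) zP //.
  suff -> : S (size (w j)) = (j \in B) by [].
  apply/existsP/idP => [[k /andP[kB /eqP kj]]|jB]; last by exists j; rewrite jB /=.
  suff <- : k = j by [].
  apply: val_inj => /=.
  by case: (ltngtP k j) => // /(increasing_lt wI)/dlt_size; rewrite kj ltnn.
- by move=> y; rewrite -sumE; apply: le_supnorm.
Qed.

Theorem theorem3p2 (R : realType) (K : topologicalType)
    (X : completeNormedModType R) (f : dyadic -> K -> X)
    (K_compact : compact [set: K]) (K_hausdorff : hausdorff_space K)
    (f_continuous : forall s, continuous (f s))
    (f_normalized : forall s, supnorm (f s) = 1)
    (f_chains : forall b, maximal_chain [set: dyadic] b ->
      (forall e, increasing_enum b e ->
         forall x : K, (fun n => f (e n) x) @ \oo --> (0 : X)) /\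
      (exists J : nat, (0 < J)%N /\
         forall s, b s -> (range (f s) #<= `I_J)%card)) :
  exists (T : set dyadic) (C : R),
    [/\ subtree T, 1 <= C &
      forall b, chains T b -> forall e, increasing_enum b e ->
        unconditional (@supnorm R K X) C (fun n => f (e n))].
Proof.
(* Pass to a cone where a single [J] serves all nodes; this makes the constant uniform over
   chains. *)
have [r [J rJ]] : exists r (J : nat), forall v, (range (f (r ++ v)) #<= `I_J)%card.
  apply: uniform_card_cone => b /f_chains[_ [J [_ Jb]]]; by exists J.
have rE := embedding_cat r.
have [||||g [gE gP]] := @unconditional_family R K X (f \o cat r) J K_compact.
- by move=> s; exact: f_continuous.
- by move=> s; exact: f_normalized.
- move=> e x delta eI.
  apply: (@increasing_small R X K f _ _ x delta (embedding_increasing rE eI)).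
  by move=> b /f_chains[].
- exact: rJ.
have rgE := embedding_comp rE gE.
exists (range (cat r \o g)), (2 * (J.+1)%:R); split.
- exact: subtree_range.
- by rewrite -natrM ler1n.
- move=> b bT e be; have [w wI ->] := subtree_chain_enum rgE bT be.
  exact: gP.
Qed.
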